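(* Let $\mu$ be any probability measure on $S$. For every $t\in\mathbb R$, $P_t$ defines a bounded operator on $\mathcal L$, and $\|P_t-P\|_{\mathcal L}=O\bigl(\varepsilon(t)+|t|\bigr)$ as $t\to0$ (where $\|\cdot\|_{\mathcal L}$ denotes the operator norm on $\mathcal L$). In particular $\|P_t-P\|_{\mathcal L}\to0$ as $t\to0$.
   Context: $S$ is the semigroup of real $q\times q$ matrices with nonnegative entries such that every row and every column contains a strictly positive entry. $\|x\|=\sum_i|x_i|$; $\overline B=\{x\in\mathbb R^q:x_i\ge0,\ \|x\|=1\}$; $g\cdot x=gx/\|gx\|$; $\xi(g,x)=\ln\|gx\|$. For $x,y\in\overline B$, $m(x,y)=\min\{x_i/y_i:y_i>0\}$, $d(x,y)=\frac{1-m(x,y)m(y,x)}{1+m(x,y)m(y,x)}$. $\mathcal L$ is the Banach space of complex functions $f$ on $\overline B$ with $\mathrm{Lip}(f)=\sup\{|f(x)-f(x')|/d(x,x'):x\ne x'\}<\infty$, with norm $\|f\|_{\mathcal L}=\sup_{\overline B}|f|+\mathrm{Lip}(f)$. $Pf(x)=\int_S f(g\cdot x)d\mu(g)$ and $P_tf(x)=\int_S e^{it\xi(g,x)}f(g\cdot x)d\mu(g)$. For $g\in S$: $\|g\|=\sup_{x\in\overline B}\|gx\|$, $v(g)=\inf_{x\in\overline B}\|gx\|$, $\ell(g)=|\ln\|g\||+|\ln v(g)|$; $\varepsilon(t)=\int_S\min\{|t|\ell(g),2\}\,d\mu(g)$. *)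

(* Defs.v *)
From HB Require Import structures.
From mathcomp Require Import all_boot all_order all_algebra.
From mathcomp Require Import all_classical all_reals all_analysis.
From mathcomp Require Import complex.
Set Implicit Arguments. Unset Strict Implicit. Unset Printing Implicit Defensive.
Import Order.TTheory GRing.Theory Num.Theory.
Import numFieldNormedType.Exports.
Local Open Scope classical_set_scope.
Local Open Scope ring_scope.

Section Defs.
Variables (R : realType) (q : nat).

Notation vec := 'cV[R]_q.
Notation mat := 'M[R]_q.

Definition l1norm (x : vec) : R := \sum_(i < q) `|x i 0|.

Definition inS (g : mat) : Prop :=
  (forall i j, 0 <= g i j) /\
  (forall i, exists j, 0 < g i j) /\
  (forall j, exists i, 0 < g i j).

Definition Bbar : set vec :=
  fun x : vec => (forall i, 0 <= x i 0) /\ l1norm x = 1.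

Definition act (g : mat) (x : vec) : vec := (l1norm (g *m x))^-1 *: (g *m x).

Definition xi (g : mat) (x : vec) : R := ln (l1norm (g *m x)).

Definition mfun (x y : vec) : R :=
  inf [set x i 0 / y i 0 | i in [set i : 'I_q | 0 < y i 0]].

Definition dist (x y : vec) : R :=
  (1 - mfun x y * mfun y x) / (1 + mfun x y * mfun y x).

(* complex-valued functions on the simplex (values off Bbar are irrelevant) *)
Definition cfun := vec -> R[i].

Definition supnorm (f : cfun) : \bar R :=
  ereal_sup [set (ComplexField.Normc.normc (f x))%:E | x in Bbar].

(* Lip(f) = sup { |f x - f x'| / d(x,x') : x <> x' in Bbar }
   (0 is adjoined so that the sup of the empty family, i.e. q = 1, is 0;
   it does not change the sup otherwise since all ratios are >= 0) *)
Definition Lip (f : cfun) : \bar R :=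
  ereal_sup (0%E |` [set r | exists x y, Bbar x /\ Bbar y /\ x <> y /\
                     r = (ComplexField.Normc.normc (f x - f y) / dist x y)%:E]).

Definition normL (f : cfun) : \bar R := (supnorm f + Lip f)%E.

Definition inL (f : cfun) : Prop := (normL f < +oo)%E.

Definition opnormL (A : cfun -> cfun) : \bar R :=
  ereal_sup [set normL (A f) | f in [set f | (normL f <= 1)%E]].

Definition gnorm (g : mat) : R := sup [set l1norm (g *m x) | x in Bbar].
Definition vmin (g : mat) : R := inf [set l1norm (g *m x) | x in Bbar].
Definition ell (g : mat) : R := `|ln (gnorm g)| + `|ln (vmin g)|.

End Defs.

Section Operators.
Context (R : realType) (q : nat) (d : measure_display) (T : measurableType d).
Variables (mu : probability T R) (G : T -> 'M[R]_q).
(* mu is the law of the random matrix G (a measurable map into S) *)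

Definition cintegral (h : T -> R[i]) : R[i] :=
  (Rintegral mu setT (fun w => complex.Re (h w)))%:C%C
  + 'i%C * (Rintegral mu setT (fun w => complex.Im (h w)))%:C%C.

Definition cintegrable (h : T -> R[i]) : Prop :=
  mu.-integrable setT (fun w => (complex.Re (h w))%:E) /\
  mu.-integrable setT (fun w => (complex.Im (h w))%:E).

Definition cexpi (a : R) : R[i] := Complex (cos a) (sin a).

Definition Pt_integrand (t : R) (f : cfun R q) (x : 'cV[R]_q) : T -> R[i] :=
  fun w => cexpi (t * xi (G w) x) * f (act (G w) x).

Definition Pt (t : R) (f : cfun R q) : cfun R q :=
  fun x => cintegral (Pt_integrand t f x).

Definition Pop (f : cfun R q) : cfun R q :=
  fun x => cintegral (fun w => f (act (G w) x)).

Definition epsilon (t : R) : R :=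
  Rintegral mu setT (fun w => Num.min (`|t| * ell (G w)) 2).

End Operators.

(* Main.v *)
Require Import Defs.
From HB Require Import structures.
From mathcomp Require Import all_boot all_order all_algebra.
From mathcomp Require Import all_classical all_reals all_analysis.
From mathcomp Require Import complex.
From mathcomp Require Import measurable_realfun ring lra.
Import Order.TTheory GRing.Theory Num.Theory.
Import numFieldNormedType.Exports ComplexField.Normc.
Local Open Scope classical_set_scope.
Local Open Scope ring_scope.

Local Notation mfun := Defs.mfun.
Local Notation gnorm := Defs.gnorm.

(** Write M = m(x,y) m(y,x), so that d = (1 - M) / (1 + M).  A matrix g in S
preserves coordinatewise inequalities, hence can only increase M, so it
contracts d; likewise |xi(g,x) - xi(g,y)| <= 1/M - 1, which is O(d(x,y)) as
long as d(x,y) <= 1/2.  With |xi(g,x)| <= ell(g) this bounds the phases by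
|e^{it xi(g,x)} - 1| <= 2 min(|t| ell(g), 2) and
|e^{it xi(g,x)} - e^{it xi(g,y)}| <= 8 d(x,y) (|t| + min(|t| ell(g), 2)),
where for d(x,y) > 1/2 the second bound follows from the first.  Integrating
the product rule for (e^{it xi} - 1) f(g . x) gives the operator estimate, and
epsilon(t) -> 0 by dominated convergence. *)

(** * Coordinate ratios on the cone and the projective metric [dist] *)

Section Cone.
Context {R : realType} {q : nat}.
Implicit Types (x y h : 'cV[R]_q) (g : 'M[R]_q).

Definition nneg x := forall i, 0 <= x i 0.

Definition normalize x : 'cV[R]_q := (l1norm x)^-1 *: x.

Lemma l1norm_ge0 x : 0 <= l1norm x.
Proof. by apply: sumr_ge0 => i _; exact: normr_ge0. Qed.

Lemma l1norm_nneg x : nneg x -> l1norm x = \sum_(i < q) x i 0.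
Proof. by move=> x0; apply: eq_bigr => i _; rewrite ger0_norm. Qed.

Lemma l1normZ (a : R) x : 0 <= a -> l1norm (a *: x) = a * l1norm x.
Proof.
by move=> a0; rewrite /l1norm mulr_sumr; apply: eq_bigr => i _; rewrite mxE normrM ger0_norm.
Qed.

Lemma l1norm_gt0P x : 0 < l1norm x -> nneg x -> exists i, 0 < x i 0.
Proof.
move=> x0 nx; apply: contrapT => /forallNP H; move: x0.
rewrite l1norm_nneg// big1 ?ltxx// => i _.
by apply/eqP; rewrite eq_le nx andbT leNgt; apply/negP/H.
Qed.

Lemma l1norm_le (c : R) x y : nneg x -> nneg y ->
  (forall i, c * y i 0 <= x i 0) -> c * l1norm y <= l1norm x.
Proof.
by move=> nx ny H; rewrite !l1norm_nneg// mulr_sumr; apply: ler_sum => i _; exact: H.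
Qed.

Lemma Bbar_nneg x : Bbar x -> nneg x. Proof. by case. Qed.

Lemma Bbar_gt0 x : Bbar x -> 0 < l1norm x. Proof. by case=> _ ->. Qed.

#[local] Hint Resolve Bbar_nneg Bbar_gt0 : core.

Lemma Bbar_normalize x : nneg x -> 0 < l1norm x -> Bbar (normalize x).
Proof.
move=> nx x0; split=> [i|].
  by rewrite mxE mulr_ge0 ?nx// invr_ge0 ltW.
by rewrite l1normZ ?invr_ge0 ?ltW// mulVf// gt_eqF.
Qed.

(** Coordinates with [y i 0 = 0] only ask for [0 <= x i 0], and [0 < l1norm y] makes the set of
    ratios nonempty, so its infimum is genuine. This turns bounds on [mfun] into coordinatewise
    inequalities, which [g] preserves. *)
Lemma le_mfun (c : R) x y : nneg x -> nneg y -> 0 < l1norm y ->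
  c <= mfun x y <-> (forall i, c * y i 0 <= x i 0).
Proof.
move=> nx ny y0; split=> [cm i|H].
  have [->|yi] := eqVneq (y i 0) 0; first by rewrite mulr0 nx.
  have yi0 : 0 < y i 0 by rewrite lt_def yi ny.
  rewrite -ler_pdivlMr//; apply: (le_trans cm); apply: ge_inf; last by exists i.
  by exists 0 => _ [j _ <-]; rewrite divr_ge0.
apply: lb_le_inf.
  by have [i yi] := l1norm_gt0P _ y0 ny; exists (x i 0 / y i 0); exists i.
by move=> _ [i yi <-]; rewrite ler_pdivlMr.
Qed.

Lemma mfun_ge0 x y : nneg x -> nneg y -> 0 < l1norm y -> 0 <= mfun x y.
Proof. by move=> nx ny y0; apply/le_mfun => // i; rewrite mul0r. Qed.

Lemma mfun_mul_le x y : nneg x -> nneg y -> 0 < l1norm y ->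
  forall i, mfun x y * y i 0 <= x i 0.
Proof. by move=> nx ny y0; apply/le_mfun. Qed.

(** Sum the inequalities [mfun x y * y i 0 <= x i 0] over [i]: both total masses are 1. *)
Lemma mfun_le1 x y : Bbar x -> Bbar y -> mfun x y <= 1.
Proof.
move=> Bx By; have := l1norm_le (mfun x y) x y (Bbar_nneg _ Bx) (Bbar_nneg _ By).
rewrite Bx.2 By.2 mulr1; apply.
by apply: mfun_mul_le; auto.
Qed.

Definition mprod x y : R := mfun x y * mfun y x.

Lemma mprod_ge0 x y : Bbar x -> Bbar y -> 0 <= mprod x y.
Proof.
by move=> Bx By; apply: mulr_ge0; apply: mfun_ge0; auto.
Qed.

Lemma mprod_le1 x y : Bbar x -> Bbar y -> mprod x y <= 1.
Proof.
by move=> Bx By; apply: mulr_ile1; rewrite ?mfun_le1 ?mfun_ge0//; auto.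
Qed.

Lemma distE x y : dist x y = (1 - mprod x y) / (1 + mprod x y).
Proof. by []. Qed.

Lemma dist_ge0 x y : Bbar x -> Bbar y -> 0 <= dist x y.
Proof.
move=> Bx By; rewrite distE; have := mprod_ge0 _ _ Bx By; have := mprod_le1 _ _ Bx By.
by move=> ? ?; rewrite divr_ge0//; lra.
Qed.

Lemma dist_le_onem (c : R) x y : Bbar x -> Bbar y -> c <= mprod x y ->
  dist x y <= 1 - c.
Proof.
move=> Bx By cm; have := mprod_ge0 _ _ Bx By; have := mprod_le1 _ _ Bx By.
by move=> ? ?; rewrite distE ler_pdivrMr; [nra|lra].
Qed.

(** The map [s -> (1 - s) / (1 + s)] decreases on [s >= 0]. *)
Lemma dist_antimono x y x' y' : Bbar x -> Bbar y -> Bbar x' -> Bbar y' ->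
  mprod x y <= mprod x' y' -> dist x' y' <= dist x y.
Proof.
move=> Bx By Bx' By' le; rewrite !distE.
have := mprod_ge0 _ _ Bx By; have := mprod_ge0 _ _ Bx' By' => ? ?.
rewrite ler_pdivrMr; last lra.
by rewrite mulrAC ler_pdivlMr; lra.
Qed.

(** Distance zero forces [mprod x y = 1]. Both factors lie between 0 and 1, so both equal 1, which
    gives [x <= y] and [y <= x] coordinatewise. *)
Lemma dist_gt0 x y : Bbar x -> Bbar y -> x <> y -> 0 < dist x y.
Proof.
move=> Bx By xy; rewrite lt_def dist_ge0// andbT; apply/eqP => d0; apply: xy.
have [nx ny] := (Bbar_nneg _ Bx, Bbar_nneg _ By).
have [x0 y0] := (Bbar_gt0 _ Bx, Bbar_gt0 _ By).
have p0 := mprod_ge0 _ _ Bx By; have p1 := mprod_le1 _ _ Bx By.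
have m1 : mprod x y = 1.
  move: d0; rewrite distE => /eqP; rewrite mulf_eq0 invr_eq0 => /orP[|] /eqP; lra.
have a0 := mfun_ge0 _ _ nx ny y0; have b0 := mfun_ge0 _ _ ny nx x0.
have a1 := mfun_le1 _ _ Bx By; have b1 := mfun_le1 _ _ By Bx.
have a : 1 <= mfun x y by move: m1; rewrite /mprod; nra.
have b : 1 <= mfun y x by move: m1; rewrite /mprod; nra.
apply/colP => i; apply/eqP; rewrite eq_le.
have /(_ i) := (le_mfun 1 _ _ nx ny y0).1 a; have /(_ i) := (le_mfun 1 _ _ ny nx x0).1 b.
by rewrite !mul1r => -> ->.
Qed.

(** Normalizing multiplies [c] and [c'] by reciprocal ratios of norms, which cancel in the product.
    Bounds on [mprod] can thus be read off unnormalized vectors. *)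
Lemma mprod_normalize_ge (c c' : R) x y : nneg x -> nneg y ->
  0 < l1norm x -> 0 < l1norm y -> 0 <= c -> 0 <= c' ->
  (forall i, c * y i 0 <= x i 0) -> (forall i, c' * x i 0 <= y i 0) ->
  c * c' <= mprod (normalize x) (normalize y).
Proof.
move=> nx ny x0 y0 c0 c0' cx cy.
have half (a : R) u v : nneg u -> nneg v -> 0 < l1norm u -> 0 < l1norm v ->
    (forall i, a * v i 0 <= u i 0) ->
    a * (l1norm v / l1norm u) <= mfun (normalize u) (normalize v).
  move=> nu nv u0 v0 H; have [nu1 nv1] := (Bbar_normalize _ nu u0, Bbar_normalize _ nv v0).
  apply/le_mfun; auto=> i.
  rewrite !mxE; have -> : a * (l1norm v / l1norm u) * ((l1norm v)^-1 * v i 0) =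
    (l1norm u)^-1 * (a * v i 0) by field; rewrite !gt_eqF.
  by rewrite ler_wpM2l// invr_ge0 ltW.
have -> : c * c' = (c * (l1norm y / l1norm x)) * (c' * (l1norm x / l1norm y)).
  by field; rewrite !gt_eqF.
by apply: ler_pM; by [rewrite mulr_ge0 ?divr_ge0 ?l1norm_ge0|apply: half].
Qed.

Lemma mulmx_nneg g x : inS g -> nneg x -> nneg (g *m x).
Proof. by case=> g0 _ nx i; rewrite mxE sumr_ge0// => j _; rewrite mulr_ge0. Qed.

(** A positive coordinate [x j 0] meets a positive entry in column [j] of [g]. *)
Lemma mulmx_l1norm_gt0 g x : inS g -> nneg x -> 0 < l1norm x -> 0 < l1norm (g *m x).
Proof.
move=> Sg nx x0; have [j xj] := l1norm_gt0P _ x0 nx.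
have [i gij] := Sg.2.2 j; rewrite l1norm_nneg; last exact: mulmx_nneg.
rewrite (bigD1 i)//= ltr_pwDl//; last first.
  by rewrite sumr_ge0// => k _; exact: mulmx_nneg.
rewrite mxE (bigD1 j)//= ltr_pwDl ?mulr_gt0// sumr_ge0// => k _.
by rewrite mulr_ge0 ?nx// Sg.1.
Qed.

Lemma mulmx_le (c : R) g x y : inS g -> (forall i, c * y i 0 <= x i 0) ->
  forall i, c * (g *m y) i 0 <= (g *m x) i 0.
Proof.
move=> Sg H i; rewrite !mxE mulr_sumr; apply: ler_sum => j _.
by rewrite mulrCA ler_wpM2l// Sg.1.
Qed.

(** * Contraction of [dist] and regularity of [xi] under a matrix in [S] *)

Section Action.
Variables (g : 'M[R]_q) (Sg : inS g).

Lemma Bbar_act x : Bbar x -> Bbar (act g x).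
Proof.
move=> Bx; apply: Bbar_normalize; first exact/mulmx_nneg/Bbar_nneg.
by apply: mulmx_l1norm_gt0 => //; [exact: Bbar_nneg|exact: Bbar_gt0].
Qed.

Lemma dist_act_le x y : Bbar x -> Bbar y -> dist (act g x) (act g y) <= dist x y.
Proof.
move=> Bx By; have [nx ny] := (Bbar_nneg _ Bx, Bbar_nneg _ By).
have [x0 y0] := (Bbar_gt0 _ Bx, Bbar_gt0 _ By).
apply: dist_antimono => //; try exact: Bbar_act.
apply: mprod_normalize_ge; try exact: mulmx_nneg; try exact: mulmx_l1norm_gt0;
  try exact: mfun_ge0; by apply: mulmx_le => //; exact: mfun_mul_le.
Qed.

(** Apply [ln u <= u - 1] to the ratio [u] of the two norms. Since [mfun y x * x <= y] survives
    multiplication by [g], [u] is at most the inverse of [mfun y x], hence of [mprod x y] because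
    [mfun x y <= 1]. *)
Lemma xi_sub_le x y : Bbar x -> Bbar y -> 0 < mprod x y ->
  xi g x - xi g y <= (mprod x y)^-1 - 1.
Proof.
move=> Bx By M0; have [nx ny] := (Bbar_nneg _ Bx, Bbar_nneg _ By).
have [x0 y0] := (Bbar_gt0 _ Bx, Bbar_gt0 _ By).
have X0 := mulmx_l1norm_gt0 _ _ Sg nx x0; have Y0 := mulmx_l1norm_gt0 _ _ Sg ny y0.
have a0 := mfun_ge0 _ _ nx ny y0; have b0 := mfun_ge0 _ _ ny nx x0.
have a1 := mfun_le1 _ _ Bx By; have b1 := mfun_le1 _ _ By Bx.
have H : mfun y x * l1norm (g *m x) <= l1norm (g *m y).
  apply: l1norm_le; [exact: mulmx_nneg|exact: mulmx_nneg|].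
  by apply: mulmx_le => //; exact: mfun_mul_le.
rewrite /xi -ln_div ?posrE//.
apply: (@le_trans _ _ (l1norm (g *m x) / l1norm (g *m y) - 1)).
  rewrite -[X in ln X](subrK 1) [X in ln X]addrC le_ln1Dx// ltrBrDl subrr divr_gt0//.
rewrite lerB// ler_pdivrMr// ler_pdivlMl//.
by apply: le_trans H; rewrite ler_wpM2r ?l1norm_ge0// /mprod ler_piMl.
Qed.

(* The cutoff 1/2 gives m(x,y) m(y,x) >= 1/3, so that 1/M - 1 is at most 4 d. *)
Lemma xi_lipschitz x y : Bbar x -> Bbar y -> dist x y <= 2^-1 ->
  `|xi g x - xi g y| <= 4 * dist x y.
Proof.
move=> Bx By d2.
have p0 := mprod_ge0 _ _ Bx By; have p1 := mprod_le1 _ _ Bx By.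
have M3 : 3^-1 <= mprod x y.
  by move: d2; rewrite distE ler_pdivrMr; lra.
have M0 : 0 < mprod x y by lra.
have K : (mprod x y)^-1 - 1 <= 4 * dist x y.
  rewrite distE mulrA ler_pdivlMr; last lra.
  have -> : ((mprod x y)^-1 - 1) * (1 + mprod x y) =
    (1 - mprod x y) * ((mprod x y)^-1 + 1) by field; rewrite gt_eqF.
  have : (mprod x y)^-1 <= 3 by rewrite -[3]invrK lef_pV2// posrE; lra.
  by move: (mprod x y)^-1 => z z3; nra.
rewrite ler_norml -lerN2 opprK opprB andbC; apply/andP; split.
  exact: (le_trans (xi_sub_le _ _ Bx By M0)).
apply: (le_trans (xi_sub_le y x By Bx _)); rewrite /mprod mulrC //.
Qed.

End Action.

End Cone.

(** * The quantities [gnorm], [vmin] and [ell] through column sums *)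

Section MatrixNorms.
Context {R : realType} {q : nat}.
Implicit Types (x y : 'cV[R]_q) (g : 'M[R]_q).

#[local] Hint Resolve Bbar_nneg Bbar_gt0 : core.

(** For [g] in [S], the map [x -> l1norm (g *m x)] is linear on the simplex, and these are its
    values at the vertices. *)
Definition colsum g j : R := \sum_(i < q) g i j.

Lemma l1norm_mulmx g x : inS g -> Bbar x ->
  l1norm (g *m x) = \sum_(j < q) colsum g j * x j 0.
Proof.
move=> Sg Bx; rewrite l1norm_nneg; last exact/mulmx_nneg/Bbar_nneg.
under eq_bigr do rewrite mxE.
by rewrite exchange_big; apply: eq_bigr => j _; rewrite mulr_suml.
Qed.

Lemma colsum_gt0 g j : inS g -> 0 < colsum g j.
Proof.
move=> Sg; have [i gij] := Sg.2.2 j; rewrite /colsum (bigD1 i)//= ltr_pwDl//.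
by rewrite sumr_ge0// => k _; rewrite Sg.1.
Qed.

Lemma Bbar_sum x : Bbar x -> \sum_(j < q) x j 0 = 1.
Proof. by move=> Bx; rewrite -l1norm_nneg ?Bx.2//; auto. Qed.

Lemma Bbar_delta j : Bbar (delta_mx j 0 : 'cV[R]_q).
Proof.
have n : nneg (delta_mx j 0 : 'cV[R]_q) by move=> i; rewrite mxE.
split=> //; rewrite l1norm_nneg// (bigD1 j)//= big1 ?addr0; first by rewrite mxE !eqxx.
by move=> i ij; rewrite mxE (negbTE ij).
Qed.

Lemma l1norm_mulmx_delta g j : inS g -> l1norm (g *m delta_mx j 0) = colsum g j.
Proof.
move=> Sg; rewrite l1norm_mulmx//; last exact: Bbar_delta.
rewrite (bigD1 j)//= big1 ?addr0; first by rewrite mxE !eqxx mulr1.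
by move=> i ij; rewrite mxE (negbTE ij) mulr0.
Qed.

Lemma l1norm_mulmx_le g x : inS g -> Bbar x ->
  l1norm (g *m x) <= \big[Num.max/0]_(j < q) colsum g j.
Proof.
move=> Sg Bx; rewrite l1norm_mulmx// -[leRHS]mulr1 -(Bbar_sum _ Bx) mulr_sumr.
by apply: ler_sum => j _; rewrite ler_wpM2r ?Bx.1// le_bigmax.
Qed.

(** A linear form on a simplex attains its maximum at a vertex. The base value 0 is harmless because
    column sums are positive. *)
Lemma gnormE g : (0 < q)%N -> inS g ->
  gnorm g = \big[Num.max/0]_(j < q) colsum g j.
Proof.
move=> q0 Sg; have le x : Bbar x -> l1norm (g *m x) <= \big[Num.max/0]_(j < q) colsum g j.
  exact: l1norm_mulmx_le.
have ub j : colsum g j <= gnorm g.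
  rewrite -l1norm_mulmx_delta//; apply: ub_le_sup.
    by exists (\big[Num.max/0]_(j < q) colsum g j) => _ [x Bx <-]; exact: le.
  by exists (delta_mx j 0) => //; exact: Bbar_delta.
apply/eqP; rewrite eq_le; apply/andP; split.
  apply: ge_sup; last by move=> _ [x Bx <-]; exact: le.
  exists (l1norm (g *m delta_mx (Ordinal q0) 0)).
  by exists (delta_mx (Ordinal q0) 0) => //; exact: Bbar_delta.
apply: bigmax_le => [|j _ //].
exact: (le_trans (ltW (colsum_gt0 g (Ordinal q0) Sg)) (ub _)).
Qed.

(** The minimum is attained at a vertex as well. The base value is itself a column sum, since a base
    0 would make the minimum 0. *)
Lemma vminE g (j0 : 'I_q) : inS g ->
  vmin g = \big[Num.min/colsum g j0]_(j < q) colsum g j.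
Proof.
move=> Sg; have le x : Bbar x -> \big[Num.min/colsum g j0]_(j < q) colsum g j <= l1norm (g *m x).
  move=> Bx; rewrite l1norm_mulmx// -[leLHS]mulr1 -(Bbar_sum _ Bx) mulr_sumr.
  by apply: ler_sum => j _; rewrite ler_wpM2r ?Bx.1// bigmin_le.
have lb j : vmin g <= colsum g j.
  rewrite -l1norm_mulmx_delta//; apply: ge_inf.
    by exists (\big[Num.min/colsum g j0]_(j < q) colsum g j) => _ [x Bx <-]; exact: le.
  by exists (delta_mx j 0) => //; exact: Bbar_delta.
apply/eqP; rewrite eq_le; apply/andP; split.
  by apply: le_bigmin.
apply: lb_le_inf; last by move=> _ [x Bx <-]; exact: le.
by exists (l1norm (g *m delta_mx j0 0)); exists (delta_mx j0 0) => //; exact: Bbar_delta.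
Qed.

Lemma vmin_gt0 g : (0 < q)%N -> inS g -> 0 < vmin g.
Proof.
move=> q0 Sg; rewrite (vminE _ (Ordinal q0))//; apply: lt_bigmin => [|j _];
exact: colsum_gt0.
Qed.

Lemma ell_ge0 g : 0 <= ell g.
Proof. exact: addr_ge0. Qed.

(** Here [l1norm (g *m x)] lies between [vmin g > 0] and [gnorm g], and [ln] is increasing on
    positive reals. *)
Lemma norm_xi_le g x : (0 < q)%N -> inS g -> Bbar x -> `|xi g x| <= ell g.
Proof.
move=> q0 Sg Bx; have v0 := vmin_gt0 _ q0 Sg.
have vx : vmin g <= l1norm (g *m x).
  by apply: ge_inf; [exists 0 => _ [y _ <-]; exact: l1norm_ge0|exists x].
have xg : l1norm (g *m x) <= gnorm g.
  apply: ub_le_sup; last by exists x.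
  exists (\big[Num.max/0]_(j < q) colsum g j) => _ [y By <-].
  exact: l1norm_mulmx_le.
have X0 : 0 < l1norm (g *m x) by exact: lt_le_trans vx.
have g0 : 0 < gnorm g by exact: lt_le_trans xg.
have h1 : ln (vmin g) <= xi g x by rewrite ler_ln ?posrE.
have h2 : xi g x <= ln (gnorm g) by rewrite ler_ln ?posrE.
rewrite ler_norml /ell; apply/andP; split.
  by have := ler_norm (- ln (vmin g)); rewrite normrN; have := normr_ge0 (ln (gnorm g)); lra.
by have := ler_norm (ln (gnorm g)); have := normr_ge0 (ln (vmin g)); lra.
Qed.

End MatrixNorms.

(** * Measurability of [xi] and [ell] along the random matrix *)

Section Measurability.
Context {R : realType} {d : measure_display} {T : measurableType d}.

Lemma measurable_bigmax (I : Type) (s : seq I) (a : R) (h : I -> T -> R) :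
  (forall i, measurable_fun setT (h i)) ->
  measurable_fun setT (fun w => \big[Num.max/a]_(i <- s) h i w).
Proof.
move=> mh; elim: s => [|i s IH]; first by under eq_fun do rewrite big_nil; exact: measurable_cst.
by under eq_fun do rewrite big_cons; exact: measurable_maxr.
Qed.

Lemma measurable_bigmin (I : Type) (s : seq I) (a : T -> R) (h : I -> T -> R) :
  measurable_fun setT a -> (forall i, measurable_fun setT (h i)) ->
  measurable_fun setT (fun w => \big[Num.min/a w]_(i <- s) h i w).
Proof.
move=> ma mh; elim: s => [|i s IH]; first by under eq_fun do rewrite big_nil.
by under eq_fun do rewrite big_cons; exact: measurable_minr.
Qed.

Lemma measurable_l1norm q (h : T -> 'cV[R]_q) :
  (forall i, measurable_fun setT (fun w => h w i 0)) ->
  measurable_fun setT (fun w => l1norm (h w)).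
Proof.
by move=> mh; apply: measurable_sum => i; apply: measurableT_comp => //; exact: mh.
Qed.

Section RandomMatrix.
Context {q : nat} (G : T -> 'M[R]_q).
Hypothesis G_meas : forall i j, measurable_fun setT (fun w => G w i j).
Hypothesis G_S : forall w, inS (G w).

Lemma measurable_mulmx_coord (x : 'cV[R]_q) i :
  measurable_fun setT (fun w => (G w *m x) i 0).
Proof.
under eq_fun do rewrite mxE.
by apply: measurable_sum => j; apply: measurable_funM => //; exact: measurable_cst.
Qed.

Lemma measurable_xi (x : 'cV[R]_q) : measurable_fun setT (fun w => xi (G w) x).
Proof.
rewrite /xi; apply: (measurableT_comp (@measurable_ln R)).
by apply: measurable_l1norm; exact: measurable_mulmx_coord.
Qed.

(** The supremum and infimum over the simplex become a finite maximum and minimum of column sums. *)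
Lemma measurable_ell : (0 < q)%N -> measurable_fun setT (fun w => ell (G w)).
Proof.
move=> q0; have mc j : measurable_fun setT (fun w => colsum (G w) j).
  by apply: measurable_sum => i; exact: G_meas.
rewrite /ell; apply: measurable_funD; apply: measurableT_comp => //;
  apply: (measurableT_comp (@measurable_ln R)).
  by under eq_fun do rewrite gnormE//; exact: measurable_bigmax.
by under eq_fun do rewrite (vminE _ (Ordinal q0))//; exact: measurable_bigmin.
Qed.

End RandomMatrix.
End Measurability.

(** * Modulus estimates and Lipschitz bounds for the phase [cexpi] *)

Section ComplexEstimates.
Context {R : realType}.
Implicit Types (z : R[i]) (a b : R).

Lemma norm_Re_le z : `|complex.Re z| <= normc z.
Proof. by case: z => a b /=; rewrite -sqrtr_sqr ler_wsqrtr// lerDl sqr_ge0. Qed.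

Lemma norm_Im_le z : `|complex.Im z| <= normc z.
Proof. by case: z => a b /=; rewrite -sqrtr_sqr ler_wsqrtr// lerDr sqr_ge0. Qed.

Lemma normc_le_ReIm z : normc z <= `|complex.Re z| + `|complex.Im z|.
Proof.
case: z => a b /=; have s0 : 0 <= `|a| + `|b| by rewrite addr_ge0.
rewrite -[leRHS]ger0_norm// -sqrtr_sqr ler_wsqrtr// sqrrD !real_normK ?num_real//.
by rewrite lerD2r lerDl mulrn_wge0// mulr_ge0.
Qed.

Lemma normc_ge0 z : 0 <= normc z.
Proof. by apply: le_trans (norm_Re_le z). Qed.

Lemma normc_cexpi a : normc (cexpi a) = 1.
Proof. by rewrite /cexpi /= cos2Dsin2 sqrtr1. Qed.

Lemma cexpi0 : cexpi 0 = 1 :> R[i].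
Proof. by rewrite /cexpi cos0 sin0. Qed.

Lemma lipschitz_derive_le1 (f df : R -> R) :
  (forall x : R, is_derive x 1 f (df x)) -> (forall x, `|df x| <= 1) ->
  forall a b, `|f a - f b| <= `|a - b|.
Proof.
move=> fdf df1; have cf : continuous f.
  by move=> x; apply: differentiable_continuous; apply/derivable1_diffP; have [] := fdf x.
have H a b : a <= b -> `|f b - f a| <= `|b - a|.
  move=> ab; have [c _ ->] := @MVT_segment R f df a b ab (fun x _ => fdf x)
    (continuous_subspaceT cf).
  by rewrite normrM ler_piMl.
move=> a b; have [ab|/ltW ba] := leP a b; last exact: H.
by rewrite distrC [leRHS]distrC; exact: H.
Qed.

Lemma cos_lipschitz a b : `|cos a - cos b| <= `|a - b|.
Proof.
apply: (lipschitz_derive_le1 _ _ (@is_derive_cos R)) => x.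
by rewrite normrN ler_norml sin_geN1 sin_le1.
Qed.

Lemma sin_lipschitz a b : `|sin a - sin b| <= `|a - b|.
Proof.
apply: (lipschitz_derive_le1 _ _ (@is_derive_sin R)) => x.
by rewrite ler_norml cos_geN1 cos_le1.
Qed.

(** The factor 2 adds the 1-Lipschitz bounds for [cos] and [sin]. *)
Lemma normc_cexpi_sub a b : normc (cexpi a - cexpi b) <= 2 * `|a - b|.
Proof.
apply: (le_trans (normc_le_ReIm _)); rewrite /cexpi /=.
by have := cos_lipschitz a b; have := sin_lipschitz a b; lra.
Qed.

Lemma normc_cexpi_sub_le2 a b : normc (cexpi a - cexpi b) <= 2.
Proof. by apply: (le_trans (le_normcD _ _)); rewrite normcN !normc_cexpi; lra. Qed.

End ComplexEstimates.

(** * The norm of [L] expressed by real inequalities *)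

Section FunctionSpace.
Context {R : realType} {q : nat}.
Implicit Types (x y : 'cV[R]_q) (f : cfun R q).

(** The product form [b * dist x y] covers [x = y] and avoids division; real constants replace
    extended ones. *)
Definition bounded_lip f a b :=
  (forall x, Bbar x -> normc (f x) <= a) /\
  (forall x y, Bbar x -> Bbar y -> normc (f x - f y) <= b * dist x y).

Lemma normL_le f a b : 0 <= b -> bounded_lip f a b -> (normL f <= (a + b)%:E)%E.
Proof.
move=> b0 [fa fb]; rewrite EFinD; apply: leeD.
  by apply: ge_ereal_sup => _ [x Bx <-]; rewrite lee_fin fa.
apply: ge_ereal_sup => _ [->|[x [y [Bx [By [xy ->]]]]]]; rewrite lee_fin//.
by rewrite ler_pdivrMr ?fb//; exact: dist_gt0.
Qed.

Lemma Lip_ge0 f : (0 <= Lip f)%E.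
Proof. by apply: ereal_sup_ubound; left. Qed.

(** With [0 < q] the simplex has a vertex; the supremum over an empty set would be [-oo]. *)
Lemma supnorm_ge0 f : (0 < q)%N -> (0 <= supnorm f)%E.
Proof.
move=> q0; apply: (@le_trans _ _ (normc (f (delta_mx (Ordinal q0) 0)))%:E).
  by rewrite lee_fin normc_ge0.
by apply: ereal_sup_ubound; exists (delta_mx (Ordinal q0) 0) => //; exact: Bbar_delta.
Qed.

Lemma normL_ge0 f : (0 < q)%N -> (0 <= normL f)%E.
Proof. by move=> q0; rewrite adde_ge0 ?supnorm_ge0 ?Lip_ge0. Qed.

(** Both summands of [normL f] are nonnegative, so each is at most their sum. *)
Lemma bounded_lip_normL f (c : R) : (0 < q)%N -> (normL f <= c%:E)%E -> bounded_lip f c c.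
Proof.
move=> q0 fc; have := supnorm_ge0 f q0; have := Lip_ge0 f => L0 s0.
have sc : (supnorm f <= c%:E)%E by apply: le_trans fc; rewrite leeDl.
have Lc : (Lip f <= c%:E)%E by apply: le_trans fc; rewrite leeDr.
split=> [x Bx|x y Bx By].
  by rewrite -lee_fin; apply: le_trans sc; apply: ereal_sup_ubound; exists x.
have [->|/eqP xy] := eqVneq x y.
  rewrite subrr normc0 mulr_ge0//; last exact: dist_ge0.
  by rewrite -lee_fin; exact: le_trans sc.
rewrite -ler_pdivrMr; last exact: dist_gt0.
rewrite -lee_fin; apply: le_trans Lc; apply: ereal_sup_ubound; right.
by exists x, y.
Qed.

Lemma inL_bounded_lip f : (0 < q)%N -> inL f -> exists2 a, 0 <= a & bounded_lip f a a.
Proof.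
move=> q0; rewrite /inL; have := normL_ge0 f q0.
have := @bounded_lip_normL f (fine (normL f)) q0.
by case: (normL f) => [r| |]//= H r0 _; exists r => //; exact: H.
Qed.

Lemma bounded_lip_eq f f' a b : (forall x, Bbar x -> f x = f' x) ->
  bounded_lip f' a b -> bounded_lip f a b.
Proof.
by move=> ff' [fa fb]; split=> [x Bx|x y Bx By]; rewrite !ff'//; [exact: fa|exact: fb].
Qed.

End FunctionSpace.

(** * Countably-valued approximation in [dist] and measurability of Lipschitz functions *)

Section Discretization.
Context {R : realType} {q : nat}.
Implicit Types (x y : 'cV[R]_q).

#[local] Hint Resolve Bbar_nneg Bbar_gt0 : core.

(* Rounding up preserves the support; this matters because [dist] is 1 between
   points of [Bbar] with different supports. *)
Definition discretize (n : nat) x : 'cV[R]_q :=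
  \col_i (Num.ceil (n.+1%:R * x i 0))%:~R.

Lemma discretize_ge n x i : n.+1%:R * x i 0 <= discretize n x i 0.
Proof. by rewrite mxE; have /andP[] := ceil_itv (n.+1%:R * x i 0). Qed.

Lemma discretize_lt n x i : discretize n x i 0 < n.+1%:R * x i 0 + 1.
Proof.
by rewrite mxE -ltrBlDr; have := ceilB1_lt (n.+1%:R * x i 0); rewrite intrB.
Qed.

Lemma discretize_nneg n x : nneg x -> nneg (discretize n x).
Proof. by move=> nx i; apply: le_trans (discretize_ge n x i); rewrite mulr_ge0. Qed.

Lemma discretize_gt0 n x : nneg x -> 0 < l1norm x -> 0 < l1norm (discretize n x).
Proof.
move=> nx x0; have : n.+1%:R * l1norm x <= l1norm (discretize n x).
  by apply: l1norm_le => //; [exact: discretize_nneg|exact: discretize_ge].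
by apply: lt_le_trans; rewrite mulr_gt0.
Qed.

(** With [N = n + 1], rounding up gives [N x <= discretize n x <= (N + K) x], so [mprod] is at least
    [N / (N + K)] and the distance at most [K / (N + K)]. *)
Lemma dist_discretize x : nneg x -> 0 < l1norm x -> exists2 K : R, 0 <= K &
  forall n, dist (normalize (discretize n x)) (normalize x) <= K / n.+1%:R.
Proof.
(* Zero coordinates contribute [0^-1 = 0]. For a positive coordinate, [1 <= K * x i 0] absorbs the
   rounding error. *)
move=> nx x0; pose K := \sum_(i < q) (x i 0)^-1.
have K0 : 0 <= K by apply: sumr_ge0 => i _; rewrite invr_ge0.
exists K => // n; set N : R := n.+1%:R; have N0 : 0 < N by rewrite ltr0n.
have NK : 0 < N + K by lra.
have nd := discretize_nneg n x nx; have d0 := discretize_gt0 n x nx x0.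
have B1 := Bbar_normalize _ nd d0; have B2 := Bbar_normalize _ nx x0.
have H : N * (N + K)^-1 <= mprod (normalize (discretize n x)) (normalize x).
  apply: mprod_normalize_ge => //; rewrite ?invr_ge0 ?(ltW N0) ?(ltW NK)// => i.
    exact: discretize_ge.
  rewrite ler_pdivrMl//.
  have [xi0|xi0] := eqVneq (x i 0) 0.
    by rewrite mxE xi0 !mulr0 ceil0.
  apply: (le_trans (ltW (discretize_lt n x i))); rewrite mulrDl lerD2l.
  apply: (@le_trans _ _ ((x i 0)^-1 * x i 0)); first by rewrite mulVf.
  rewrite ler_wpM2r// /K (bigD1 i)//= lerDl sumr_ge0// => j _.
  by rewrite invr_ge0.
apply: (le_trans (dist_le_onem _ _ _ B1 B2 H)).
have -> : 1 - N * (N + K)^-1 = K / (N + K).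
  by rewrite -[X in X - _](divff (lt0r_neq0 NK)) -mulrBl addrAC subrr add0r.
by apply: ler_wpM2l => //; rewrite lef_pV2 ?posrE//; lra.
Qed.

Context {d : measure_display} {T : measurableType d}.

Lemma measurable_ceil_fiber (u : T -> R) (k : int) : measurable_fun setT u ->
  measurable [set w | Num.ceil (u w) = k].
Proof.
move=> mu; have -> : [set w | Num.ceil (u w) = k] = setT `&` u @^-1` `](k - 1)%:~R, k%:~R]%classic.
  apply/seteqP; split=> w /=.
    by move=> <-; split=> //; rewrite in_itv/= ceil_itv.
  by move=> [_]; rewrite in_itv/=; exact: ceil_def.
exact: mu.
Qed.

(** The discretized vector takes countably many values, each on a measurable set, so [phi] may be
    arbitrary. *)
Lemma measurable_discretize (h : T -> 'cV[R]_q) n (phi : 'cV[R]_q -> R) :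
  (forall i, measurable_fun setT (fun w => h w i 0)) ->
  measurable_fun setT (fun w => phi (discretize n (h w))).
Proof.
move=> mh; pose kk w : {ffun 'I_q -> int} := [ffun i => Num.ceil (n.+1%:R * h w i 0)].
pose F (k : {ffun 'I_q -> int}) := phi (\col_i (k i)%:~R).
have FE w : phi (discretize n (h w)) = F (kk w).
  by congr phi; apply/colP => i; rewrite !mxE ffunE.
have mk k : measurable [set w | kk w = k].
  have -> : [set w | kk w = k] =
      \bigcap_(i in [set: 'I_q]) [set w | Num.ceil (n.+1%:R * h w i 0) = k i].
    apply/seteqP; split=> w /=.
      by move=> <- i _ /=; rewrite ffunE.
    by move=> H; apply/ffunP => i; rewrite ffunE; exact: H.
  apply: fin_bigcap_measurable => [|i _]; first exact: finite_finset.
  by apply: measurable_ceil_fiber; apply: measurable_funM => //; exact: measurable_cst.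
move=> _ B mB; rewrite setTI.
have -> : (fun w => phi (discretize n (h w))) @^-1` B =
    \bigcup_k (if `[< B (F k) >] then [set w | kk w = k] else set0).
  apply/seteqP; split=> w /=.
    by rewrite FE => Bw; exists (kk w) => //; rewrite asboolT.
  by move=> [k _]; case: asboolP => //= Bk wk; rewrite FE wk.
apply: countable_bigcupT_measurable; first exact: countableP.
by move=> k; case: ifP.
Qed.

(* [dist] is not continuous for the usual topology at boundary points, so a
   Lipschitz function need not be continuous there: measurability comes from
   countably-valued approximation instead. *)
Lemma measurable_lipschitz_normalize (phi : 'cV[R]_q -> R) (b : R) (h : T -> 'cV[R]_q) :
  (forall x y, Bbar x -> Bbar y -> `|phi x - phi y| <= b * dist x y) ->
  (forall i, measurable_fun setT (fun w => h w i 0)) ->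
  (forall w, nneg (h w)) -> (forall w, 0 < l1norm (h w)) ->
  measurable_fun setT (fun w => phi (normalize (h w))).
Proof.
move=> lphi mh nh h0.
apply: (@measurable_fun_cvg _ _ _ setT
  (fun n w => phi (normalize (discretize n (h w))))).
  by move=> n; exact: (measurable_discretize h n (phi \o normalize)).
(* [K] depends on [w], which suffices for pointwise convergence. *)
move=> w _; have [K K0 HK] := dist_discretize (h w) (nh w) (h0 w).
apply/cvgrPdist_le => e e0.
have H n : `|phi (normalize (h w)) - phi (normalize (discretize n (h w)))| <=
    (`|b| * K) * n.+1%:R^-1.
  rewrite distrC -mulrA; apply: le_trans (ler_wpM2l (normr_ge0 b) (HK n)).
  have B1 := Bbar_normalize _ (discretize_nneg n _ (nh w)) (discretize_gt0 n _ (nh w) (h0 w)).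
  have B2 := Bbar_normalize _ (nh w) (h0 w).
  apply: (le_trans (lphi _ _ B1 B2)); rewrite ler_wpM2r ?ler_norm//.
  exact: dist_ge0.
have c0 : (`|b| * K) * n.+1%:R^-1 @[n --> \oo] --> (0 : R).
  by rewrite -[X in _ --> X](mulr0 (`|b| * K)); apply: cvgMr; exact: cvg_harmonic.
move/cvgrPdist_le : c0 => /(_ e e0); apply: filterS => n.
rewrite sub0r normrN => /(le_trans (ler_norm _)).
exact: le_trans (H n).
Qed.

End Discretization.

(** * Complex integrals through real and imaginary parts *)

Section ComplexIntegral.
Context {R : realType} {d : measure_display} {T : measurableType d}.
Variable mu : probability T R.

Definition cmeasurable (h : T -> R[i]) :=
  measurable_fun setT (fun w => complex.Re (h w)) /\
  measurable_fun setT (fun w => complex.Im (h w)).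

Lemma cmeasurableM (h1 h2 : T -> R[i]) :
  cmeasurable h1 -> cmeasurable h2 -> cmeasurable (fun w => h1 w * h2 w).
Proof.
move=> [r1 i1] [r2 i2]; split.
  apply: (eq_measurable_fun (fun w => complex.Re (h1 w) * complex.Re (h2 w) -
    complex.Im (h1 w) * complex.Im (h2 w))).
    by move=> w _; case: (h1 w) => ? ?; case: (h2 w).
  by apply: measurable_funB; exact: measurable_funM.
apply: (eq_measurable_fun (fun w => complex.Re (h1 w) * complex.Im (h2 w) +
  complex.Im (h1 w) * complex.Re (h2 w))).
  by move=> w _; case: (h1 w) => ? ?; case: (h2 w).
by apply: measurable_funD; exact: measurable_funM.
Qed.

Lemma cmeasurable_cexpi (u : T -> R) (c : R[i]) : measurable_fun setT u ->
  cmeasurable (fun w => cexpi (u w) - c).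
Proof.
move=> mu_; split.
  apply: (eq_measurable_fun (fun w => cos (u w) - complex.Re c)).
    by move=> w _; case: c.
  apply: measurable_funB => //; apply: measurableT_comp mu_.
  by apply: continuous_measurable_fun; exact: continuous_cos.
apply: (eq_measurable_fun (fun w => sin (u w) - complex.Im c)).
  by move=> w _; case: c.
apply: measurable_funB => //; apply: measurableT_comp mu_.
by apply: continuous_measurable_fun; exact: continuous_sin.
Qed.

Lemma integrable_le_cst (h : T -> R) (c : R) : measurable_fun setT h ->
  (forall w, `|h w| <= c) -> mu.-integrable setT (EFin \o h).
Proof.
move=> mh hc; apply: (@le_integrable _ _ _ mu setT measurableT _ (cst c%:E)).
- exact/measurable_EFinP.
- by move=> w _ /=; rewrite lee_fin (le_trans (hc w))// ler_norm.
- exact: finite_measure_integrable_cst.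
Qed.

Lemma cintegrable_le_cst (h : T -> R[i]) (c : R) : cmeasurable h ->
  (forall w, normc (h w) <= c) -> cintegrable mu h.
Proof.
move=> [mr mi] hc; split.
  by apply: (integrable_le_cst _ c mr) => w; exact: le_trans (norm_Re_le _) (hc w).
by apply: (integrable_le_cst _ c mi) => w; exact: le_trans (norm_Im_le _) (hc w).
Qed.

Lemma cintegralE (h : T -> R[i]) : cintegral mu h =
  Complex (Rintegral mu setT (fun w => complex.Re (h w)))
          (Rintegral mu setT (fun w => complex.Im (h w))).
Proof.
rewrite /cintegral; apply/eqP; rewrite eq_complex /=.
by rewrite !mul0r !mul1r subr0 !addr0 !add0r !eqxx.
Qed.

(** The factor 2 comes from bounding the real and imaginary parts separately. *)
Lemma normc_cintegral_le (h : T -> R[i]) (k : T -> R) : cintegrable mu h ->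
  mu.-integrable setT (EFin \o k) -> (forall w, normc (h w) <= k w) ->
  normc (cintegral mu h) <= 2 * Rintegral mu setT k.
Proof.
move=> [hr hi] ik hk.
have half (u : T -> R) : mu.-integrable setT (EFin \o u) ->
    (forall w, `|u w| <= k w) -> `|Rintegral mu setT u| <= Rintegral mu setT k.
  move=> iu uk; apply: (le_trans (le_normr_Rintegral measurableT iu)).
  apply: le_Rintegral => //; exact: (integrable_norm iu).
apply: (le_trans (normc_le_ReIm _)); rewrite cintegralE /=.
rewrite mulr_natl mulr2n; apply: lerD; apply: half => // w.
  exact: le_trans (norm_Re_le _) (hk w).
exact: le_trans (norm_Im_le _) (hk w).
Qed.

Lemma cintegralB (h1 h2 : T -> R[i]) : cintegrable mu h1 -> cintegrable mu h2 ->
  cintegral mu h1 - cintegral mu h2 = cintegral mu (fun w => h1 w - h2 w).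
Proof.
move=> [r1 i1] [r2 i2]; rewrite !cintegralE.
transitivity (Complex (Rintegral mu setT (fun w => complex.Re (h1 w)) -
    Rintegral mu setT (fun w => complex.Re (h2 w)))
  (Rintegral mu setT (fun w => complex.Im (h1 w)) -
    Rintegral mu setT (fun w => complex.Im (h2 w)))); first by [].
rewrite -!RintegralB//; congr Complex; apply: eq_Rintegral => w _;
  by case: (h1 w) => ? ?; case: (h2 w).
Qed.

Lemma cintegrableB (h1 h2 : T -> R[i]) : cintegrable mu h1 -> cintegrable mu h2 ->
  cintegrable mu (fun w => h1 w - h2 w).
Proof.
move=> [r1 i1] [r2 i2]; split.
  apply: eq_integrable (integrableB measurableT r1 r2) => // w _ /=.
  by case: (h1 w) => ? ?; case: (h2 w).
apply: eq_integrable (integrableB measurableT i1 i2) => // w _ /=.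
by case: (h1 w) => ? ?; case: (h2 w).
Qed.

End ComplexIntegral.

(** * Operator bounds for [P_t] and [P_t - P], and the limit at 0 *)

Section TransferOperator.
Context {R : realType} {q : nat} {d : measure_display} {T : measurableType d}.
Variables (mu : probability T R) (G : T -> 'M[R]_q).
Hypothesis q_gt0 : (0 < q)%N.
Hypothesis G_meas : forall i j, measurable_fun setT (fun w => G w i j).
Hypothesis G_S : forall w, inS (G w).

(** Since [act g x] is the normalization of [g *m x], the approximation result applies to the real
    and imaginary parts of [f], both Lipschitz with constant [b]. *)
Lemma cmeasurable_act (f : cfun R q) a b x : bounded_lip f a b -> Bbar x ->
  cmeasurable (fun w => f (act (G w) x)).
Proof.
move=> [_ fb] Bx; have [nx x0] := (Bbar_nneg _ Bx, Bbar_gt0 _ Bx).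
split.
  apply: (measurable_lipschitz_normalize (fun y => complex.Re (f y)) b
      (fun w => G w *m x)) => [y z By Bz|i|w|w].
  - apply: le_trans (fb y z By Bz); apply: le_trans (norm_Re_le _).
    by case: (f y) => ? ?; case: (f z).
  - exact: measurable_mulmx_coord.
  - exact: mulmx_nneg.
  - exact: mulmx_l1norm_gt0.
apply: (measurable_lipschitz_normalize (fun y => complex.Im (f y)) b
    (fun w => G w *m x)) => [y z By Bz|i|w|w].
- apply: le_trans (fb y z By Bz); apply: le_trans (norm_Im_le _).
  by case: (f y) => ? ?; case: (f z).
- exact: measurable_mulmx_coord.
- exact: mulmx_nneg.
- exact: mulmx_l1norm_gt0.
Qed.

(** Pointwise majorant chosen so that its integral is [epsilon mu G t + |t|]. *)
Definition phase_bound (t : R) w : R := `|t| + Num.min (`|t| * ell (G w)) 2.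

Lemma min_ell_ge0 (t : R) w : 0 <= Num.min (`|t| * ell (G w)) 2.
Proof. by rewrite le_min mulr_ge0 ?ell_ge0//=. Qed.

Lemma phase_bound_ge0 t w : 0 <= phase_bound t w.
Proof. by rewrite addr_ge0 ?min_ell_ge0. Qed.

Lemma measurable_min_ell (t : R) :
  measurable_fun setT (fun w => Num.min (`|t| * ell (G w)) 2).
Proof.
apply: measurable_minr => //; apply: measurable_funM => //.
exact: measurable_ell.
Qed.

Lemma integrable_min_ell (t : R) :
  mu.-integrable setT (EFin \o (fun w => Num.min (`|t| * ell (G w)) 2)).
Proof.
apply: (integrable_le_cst _ _ 2 (measurable_min_ell t)) => w.
by rewrite ger0_norm ?min_ell_ge0// ge_min lexx orbT.
Qed.

Lemma integrable_phase_bound t : mu.-integrable setT (EFin \o phase_bound t).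
Proof.
apply: (integrable_le_cst _ _ (`|t| + 2)).
  by apply: measurable_funD => //; exact: measurable_min_ell.
move=> w; rewrite ger0_norm ?phase_bound_ge0// lerD2l.
by rewrite ge_min lexx orbT.
Qed.

Lemma Rintegral_phase_bound t :
  Rintegral mu setT (phase_bound t) = epsilon mu G t + `|t|.
Proof.
rewrite /phase_bound RintegralD//; last exact: integrable_min_ell.
  by rewrite Rintegral_cst//= probability_setT mulr1 addrC.
exact: finite_measure_integrable_cst.
Qed.

(** Compare with the phase at 0: the Lipschitz bound gives [2 * |t| * ell], and the modulus never
    exceeds 2. *)
Lemma phase_sub1_le t x w : Bbar x ->
  normc (cexpi (t * xi (G w) x) - 1) <= 2 * Num.min (`|t| * ell (G w)) 2.
Proof.
move=> Bx; rewrite -cexpi0.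
have h1 := normc_cexpi_sub (t * xi (G w) x) 0; have h2 := normc_cexpi_sub_le2 (t * xi (G w) x) 0.
have xl : `|t| * `|xi (G w) x| <= `|t| * ell (G w) by rewrite ler_wpM2l// norm_xi_le.
rewrite subr0 normrM in h1.
by rewrite -ler_pdivrMl// le_min; apply/andP; split; lra.
Qed.

Lemma phase_lipschitz t x y w : Bbar x -> Bbar y ->
  normc (cexpi (t * xi (G w) x) - cexpi (t * xi (G w) y)) <=
    dist x y * (8 * phase_bound t w).
Proof.
move=> Bx By; have d0 := dist_ge0 _ _ Bx By; have m0 := min_ell_ge0 t w.
have t0 := normr_ge0 t; rewrite /phase_bound.
have [d2|d2] := leP (dist x y) 2^-1.
  (* Constant 8: 2 from the phase times 4 from [xi_lipschitz]. *)
  apply: (le_trans (normc_cexpi_sub _ _)); rewrite -mulrBr normrM.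
  have /(ler_wpM2l t0) := xi_lipschitz _ (G_S w) _ _ Bx By d2; nra.
(* Each difference from 1 costs twice the minimum; the total factor 4 is at most [8 * dist x y], as
   the distance exceeds 1/2. *)
have -> : cexpi (t * xi (G w) x) - cexpi (t * xi (G w) y) =
  (cexpi (t * xi (G w) x) - 1) - (cexpi (t * xi (G w) y) - 1) by ring.
apply: (le_trans (le_normcD _ _)); rewrite normcN.
have := phase_sub1_le t x w Bx; have := phase_sub1_le t y w By; nra.
Qed.

(* [c = 0] gives P_t and [c = 1] gives P_t - P. *)
Definition Pt_sub (c : R[i]) t (f : cfun R q) : cfun R q :=
  fun x => cintegral mu (fun w => (cexpi (t * xi (G w) x) - c) * f (act (G w) x)).

(** * Norm estimate shared by [P_t] and [P_t - P], from one integrable majorant [S] *)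

Section Estimate.
Variables (c : R[i]) (t : R) (S : T -> R).
Hypothesis iS : mu.-integrable setT (EFin \o S).
Hypothesis uS : forall x w, Bbar x ->
  normc (cexpi (t * xi (G w) x) - c) + 8 * phase_bound t w <= S w.

Lemma cintegrable_Pt_sub f a x : 0 <= a -> bounded_lip f a a -> Bbar x ->
  cintegrable mu (fun w => (cexpi (t * xi (G w) x) - c) * f (act (G w) x)).
Proof.
move=> a0 fa Bx; apply: (cintegrable_le_cst _ _ ((1 + normc c) * a)).
  apply: cmeasurableM; last exact: cmeasurable_act fa Bx.
  by apply: cmeasurable_cexpi; apply: measurable_funM => //; exact: measurable_xi.
move=> w; rewrite normcM; apply: ler_pM; rewrite ?normc_ge0//.
  by apply: (le_trans (le_normcD _ _)); rewrite normcN normc_cexpi.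
by apply: fa.1; exact: Bbar_act.
Qed.

Lemma S_ge0 w : 0 <= S w.
Proof.
apply: le_trans (uS _ w (Bbar_delta (Ordinal q_gt0))).
by rewrite addr_ge0 ?normc_ge0// mulr_ge0// phase_bound_ge0.
Qed.

Lemma integrable_scale (a : R) : mu.-integrable setT (EFin \o (fun w => a * S w)).
Proof.
by have := integrableZl measurableT a iS; apply: eq_integrable => // w _ /=; rewrite EFinM.
Qed.

Lemma Pt_sub_bounded_lip f a : 0 <= a -> bounded_lip f a a ->
  bounded_lip (Pt_sub c t f) (2 * (a * Rintegral mu setT S)) (2 * (a * Rintegral mu setT S)).
Proof.
move=> a0 fa; split=> [x Bx|x y Bx By].
  rewrite -RintegralZl//; apply: normc_cintegral_le.
  - exact: (cintegrable_Pt_sub _ a).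
  - exact: integrable_scale.
  move=> w; rewrite normcM mulrC; apply: ler_pM; rewrite ?normc_ge0//.
    by apply: fa.1; exact: Bbar_act.
  by apply: le_trans (uS x w Bx); rewrite lerDl mulr_ge0// phase_bound_ge0.
rewrite /Pt_sub cintegralB; [|exact: (cintegrable_Pt_sub _ a)..].
have -> : 2 * (a * Rintegral mu setT S) * dist x y =
  2 * ((dist x y * a) * Rintegral mu setT S) by ring.
rewrite -RintegralZl//; apply: normc_cintegral_le.
- by apply: cintegrableB; exact: (cintegrable_Pt_sub _ a).
- exact: integrable_scale.
move=> w; have d0 := dist_ge0 _ _ Bx By.
(* Product rule: one term uses the contraction of [dist] by [g], the other [phase_lipschitz].
   Together they give [dist x y * a] times the left side of [uS]. *)
have -> : (cexpi (t * xi (G w) x) - c) * f (act (G w) x) -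
    (cexpi (t * xi (G w) y) - c) * f (act (G w) y) =
  (cexpi (t * xi (G w) x) - c) * (f (act (G w) x) - f (act (G w) y)) +
  (cexpi (t * xi (G w) x) - cexpi (t * xi (G w) y)) * f (act (G w) y) by ring.
apply: (le_trans (le_normcD _ _)); rewrite !normcM.
apply: (@le_trans _ _ (normc (cexpi (t * xi (G w) x) - c) * (a * dist x y) +
  dist x y * (8 * phase_bound t w) * a)).
  apply: lerD; apply: ler_pM; rewrite ?normc_ge0//.
  - apply: (le_trans (fa.2 _ _ (Bbar_act _ (G_S w) _ Bx) (Bbar_act _ (G_S w) _ By))).
    by rewrite ler_wpM2l// dist_act_le.
  - exact: phase_lipschitz.
  - by apply: fa.1; exact: Bbar_act.
have := ler_wpM2l (mulr_ge0 d0 a0) (uS x w Bx); lra.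
Qed.

Lemma normL_Pt_sub_le f a : 0 <= a -> bounded_lip f a a ->
  (normL (Pt_sub c t f) <= (4 * (a * Rintegral mu setT S))%:E)%E.
Proof.
move=> a0 fa; have := normL_le _ _ _ _ (Pt_sub_bounded_lip f a a0 fa).
have -> : 4 * (a * Rintegral mu setT S) =
  2 * (a * Rintegral mu setT S) + 2 * (a * Rintegral mu setT S) by ring.
by apply; rewrite !mulr_ge0// Rintegral_ge0// => w _; exact: S_ge0.
Qed.

End Estimate.

Lemma PtE t f x : Pt mu G t f x = Pt_sub 0 t f x.
Proof.
by congr (cintegral mu _); apply/funext => w; rewrite subr0.
Qed.

Lemma Pt_integrand_integrable t f x : inL f -> Bbar x ->
  cintegrable mu (Pt_integrand G t f x).
Proof.
move=> /(inL_bounded_lip _ q_gt0)[a a0 fa] Bx.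
have := cintegrable_Pt_sub 0 t f a x a0 fa Bx.
by congr (cintegrable mu _); apply/funext => w; rewrite subr0.
Qed.

Lemma Pt_subE t f a x : 0 <= a -> bounded_lip f a a -> Bbar x ->
  Pt mu G t f x - Pop mu G f x = Pt_sub 1 t f x.
Proof.
move=> a0 fa Bx; have i1 := cintegrable_Pt_sub 0 t f a x a0 fa Bx.
(* Writing [P] as [P_0] lets the same integrability lemma serve both integrals. *)
have P0 : Pop mu G f x = cintegral mu (fun w => (cexpi (0 * xi (G w) x) - 0) * f (act (G w) x)).
  by congr (cintegral mu _); apply/funext => w; rewrite mul0r cexpi0 subr0 mul1r.
rewrite PtE P0 /Pt_sub cintegralB//; last exact: (cintegrable_Pt_sub 0 0 f a).
by congr (cintegral mu _); apply/funext => w; rewrite mul0r cexpi0 !subr0 -mulrBl.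
Qed.

Lemma normL_Pt_le t : exists2 C : R, 0 <= C & forall f a, 0 <= a -> bounded_lip f a a ->
  (normL (Pt mu G t f) <= (4 * (a * C))%:E)%E.
Proof.
(* The summand 1 is the modulus of the phase. *)
pose S w := 1 + 8 * phase_bound t w.
have iS : mu.-integrable setT (EFin \o S).
  apply: (integrable_le_cst _ _ (1 + 8 * (`|t| + 2))).
    apply: measurable_funD => //; apply: measurable_funM => //.
    by apply: measurable_funD => //; exact: measurable_min_ell.
  move=> w; rewrite ger0_norm; last by rewrite addr_ge0// mulr_ge0// phase_bound_ge0.
  by rewrite lerD2l ler_wpM2l// lerD2l ge_min lexx orbT.
have uS x w : Bbar x -> normc (cexpi (t * xi (G w) x) - 0) + 8 * phase_bound t w <= S w.
  by move=> _; rewrite subr0 normc_cexpi.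
exists (Rintegral mu setT S).
  by apply: Rintegral_ge0 => w _; exact: (S_ge0 0 t S uS).
move=> f a a0 fa; have -> : Pt mu G t f = Pt_sub 0 t f by apply/funext => x; exact: PtE.
exact: normL_Pt_sub_le.
Qed.

Lemma inL_Pt t f : inL f -> inL (Pt mu G t f).
Proof.
move=> /(inL_bounded_lip _ q_gt0)[a a0 fa]; have [C C0 H] := normL_Pt_le t.
exact: le_lt_trans (H f a a0 fa) (ltry _).
Qed.

Lemma opnormL_Pt_lty t : (opnormL (Pt mu G t) < +oo)%E.
Proof.
have [C C0 H] := normL_Pt_le t; apply: (@le_lt_trans _ _ (4 * (1 * C))%:E); last exact: ltry.
by apply: ge_ereal_sup => _ [f f1 <-]; apply: H => //; exact: bounded_lip_normL.
Qed.

Lemma opnormL_Pt_sub_le t :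
  (opnormL (fun f x => (Pt mu G t f x - Pop mu G f x)%R) <=
    (40 * (epsilon mu G t + `|t|))%:E)%E.
Proof.
(* Here 10 is 2 from [phase_sub1_le] plus 8 from [uS]. The final 40 is 10 times 2 for the complex
   integral times 2 for the two parts of [normL]. *)
pose S w := 10 * phase_bound t w.
have iS : mu.-integrable setT (EFin \o S).
  have := integrableZl measurableT 10 (integrable_phase_bound t).
  by apply: eq_integrable => // w _ /=; rewrite EFinM.
have uS x w : Bbar x -> normc (cexpi (t * xi (G w) x) - 1) + 8 * phase_bound t w <= S w.
  move=> Bx; have := phase_sub1_le t x w Bx; have := normr_ge0 t.
  by rewrite /S /phase_bound; lra.
apply: ge_ereal_sup => _ [f f1 <-].
have fa := bounded_lip_normL f 1 q_gt0 f1.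
have -> : 40 * (epsilon mu G t + `|t|) =
    2 * (1 * Rintegral mu setT S) + 2 * (1 * Rintegral mu setT S).
  by rewrite RintegralZl ?Rintegral_phase_bound//; [ring|exact: integrable_phase_bound].
apply: normL_le.
  by rewrite !mulr_ge0// Rintegral_ge0// => w _; exact: (S_ge0 1 t S uS).
apply: (bounded_lip_eq _ (Pt_sub 1 t f)) => [x Bx|]; first exact: (Pt_subE t f 1).
exact: Pt_sub_bounded_lip.
Qed.

(** Lower half of the squeeze: the zero function lies in the unit ball, so the supremum is over a
    nonempty set of nonnegative values. *)
Lemma opnormL_Pt_sub_ge0 t :
  (0 <= opnormL (fun f x => (Pt mu G t f x - Pop mu G f x)%R))%E.
Proof.
apply: le_ereal_sup_tmp.
exists (normL (fun x => Pt mu G t (fun=> 0) x - Pop mu G (fun=> 0) x)); last exact: normL_ge0.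
exists (fun=> 0) => //=; apply: (@le_trans _ _ (0 + 0)%:E); last by rewrite lee_fin addr0.
by apply: normL_le => //; split=> [x Bx|x y Bx By]; rewrite ?subrr normc0// mul0r.
Qed.

(** Continuity at 0 by dominated convergence: the truncation at 2 supplies a constant majorant,
    integrable for a probability. *)
Lemma epsilon_cvg0 : epsilon mu G t @[t --> (0 : R)] --> (0 : R).
Proof.
have e0 : epsilon mu G 0 = 0.
  rewrite /epsilon (@eq_Rintegral _ _ _ mu setT (cst 0)); first by rewrite Rintegral_cst// mul0r.
  by move=> w _; rewrite normr0 mul0r min_l.
rewrite -[X in _ --> X]e0.
have := @continuity_under_integral R d T mu
  (fun t w => Num.min (`|t| * ell (G w)) 2) setT measurableT (-1) 1.
apply=> //.
- by move=> t _; exact: integrable_min_ell.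
- apply: aeW => w _ t _;
  apply: (@continuous_min R R (fun t : R => `|t| * ell (G w)) (cst 2) t);
    last exact: cst_continuous.
  by apply: continuousM; [exact: norm_continuous|exact: cst_continuous].
- exact: (finite_measure_integrable_cst mu 2).
- move=> t _; apply: aeW => w _.
  by rewrite ger0_norm ?min_ell_ge0// ge_min lexx orbT.
- by rewrite inE /= in_itv/=; lra.
Qed.

Lemma opnormL_Pt_sub_cvg0 :
  opnormL (fun f x => (Pt mu G t f x - Pop mu G f x)%R) @[t --> (0 : R)] --> 0%E.
Proof.
apply: (@squeeze_cvge _ _ _ _ (cst 0%E) _ (fun t => (40 * (epsilon mu G t + `|t|))%:E)).
- by apply: nearW => t; rewrite opnormL_Pt_sub_ge0 opnormL_Pt_sub_le.
- exact: cvg_cst.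
apply: cvg_EFin; first exact: nearW.
rewrite -[X in _ --> X](mulr0 40); apply: cvgMr.
rewrite -[X in _ --> X](addr0 0); apply: cvgD; first exact: epsilon_cvg0.
by rewrite -[X in _ --> X](@normr0 _ R); exact: norm_continuous.
Qed.

End TransferOperator.

Theorem mainTheorem6 (R : realType) (q : nat) (d : measure_display)
    (T : measurableType d) (mu : probability T R) (G : T -> 'M[R]_q)
    (q_gt0 : (0 < q)%N)
    (G_meas : forall i j, measurable_fun setT (fun w => G w i j))
    (G_S : forall w, inS (G w)) :
  (* for every t, P_t is a well-defined bounded operator on L *)
  (forall t : R,
     (forall f : cfun R q, inL f -> forall x, Bbar x ->
        cintegrable mu (Pt_integrand G t f x)) /\
     (forall f : cfun R q, inL f -> inL (Pt mu G t f)) /\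
     (opnormL (Pt mu G t) < +oo)%E) /\
  (* ||P_t - P||_L = O(eps(t) + |t|) as t -> 0 *)
  (exists C delta : R, 0 < delta /\
     forall t : R, `|t| < delta ->
       (opnormL (fun f x => (Pt mu G t f x - Pop mu G f x)%R)
         <= (C * (epsilon mu G t + `|t|))%:E)%E) /\
  (* in particular ||P_t - P||_L -> 0 as t -> 0 *)
  (opnormL (fun f x => (Pt mu G t f x - Pop mu G f x)%R) @[t --> (0 : R)] --> 0%E).
Proof.
split; [|split].
- move=> t; split; [|split].
  + by move=> f fL x Bx; exact: Pt_integrand_integrable.
  + by move=> f; exact: inL_Pt.
  + exact: opnormL_Pt_lty.
(* The estimate holds for every [t], so [delta = 1] is an arbitrary choice. *)
- by exists 40, 1; split=> // t _; exact: opnormL_Pt_sub_le.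
- exact: opnormL_Pt_sub_cvg0.
Qed.
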